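(* There exists a universal constant $\gamma_0>0$ such that for every finite domain $X$, every linear ordering imposed on $C_{all}=2^X=\{c:X\to\{0,1\}\}$, and every linear ordering of the family $\mathcal S$ of all $C_{all}$-realizable samples that extends the ordering by cardinality (smaller samples preferred), the cost caused by the greedy matching in the consistency graph $G=(C_{all},\mathcal S,E)$ is at least $\gamma_0\cdot\log_2|C_{all}|$ $(=\gamma_0|X|)$.
   Context: A labeled example is a pair $(x,b)\in X\times\{0,1\}$; a sample is a set of labeled examples. A concept $c$ is consistent with a sample $S$ if $c(x)=b$ for all $(x,b)\in S$; $S$ is realizable by a class $C$ if some $c\in C$ is consistent with it. The consistency graph is the bipartite graph $G=(C,\mathcal S,E)$ with $E=\{(c,S): c \text{ consistent with } S\}$. Both sides are linearly ordered by preference $\succ$; the ordering on $\mathcal S$ satisfies $|S|<|S'|\Rightarrow S\succ S'$. The greedy matching is produced by: start with $M=\emptyset$; while $M$ is not maximal, let $x^*$ be the most preferred concept that is unmatched and adjacent to some unmatched sample, let $y^*$ be the most preferred unmatched sample adjacent to $x^*$, and add $\{x^*,y^*\}$ to $M$. If $S_1\succ\dots\succ S_N$ lists $\mathcal S$ and $S_k$ is the least preferred sample matched by the greedy matching, its cost is $|S_k|$. *)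

(* Defs.v *)
From HB Require Import structures.
From mathcomp Require Import all_boot all_order all_algebra.
From mathcomp Require Import reals exp.

Set Implicit Arguments.
Unset Strict Implicit.
Unset Printing Implicit Defensive.

Import Order.TTheory GRing.Theory Num.Theory.

(* [r x y] reads "x is strictly preferred to y"; only the restriction of [r]
   to [A] is constrained. *)
Definition linear_preference (T : finType) (A : {set T}) (r : rel T) : Prop :=
  [/\ {in A, irreflexive r},
      {in A & &, transitive r}
    & {in A &, forall x y, x != y -> r x y || r y x}].

Definition most_preferred (T : finType) (r : rel T) (A : {set T}) : option T :=
  [pick x in A | [forall y in A, (y == x) || r x y]].

Definition least_preferred (T : finType) (r : rel T) (A : {set T}) : option T :=
  most_preferred (fun x y => r y x) A.

Section Greedy.

Variables (T U : finType) (A : {set T}) (B : {set U}) (adj : T -> U -> bool).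
Variables (prefA : rel T) (prefB : rel U).

Implicit Type M : {set T * U}.

Definition is_matching M : bool :=
  [forall e in M, [&& e.1 \in A, e.2 \in B & adj e.1 e.2]] &&
  [forall e in M, forall f in M, (e.1 == f.1) || (e.2 == f.2) ==> (e == f)].

Definition matched_left M : {set T} := [set e.1 | e in M].
Definition matched_right M : {set U} := [set e.2 | e in M].

Definition free_neighbours M (x : T) : {set U} :=
  [set y in B | (y \notin matched_right M) && adj x y].

Definition free_candidates M : {set T} :=
  [set x in A | (x \notin matched_left M) && (free_neighbours M x != set0)].

(* [M] is left unchanged exactly when no candidate remains, i.e. when [M] is
   a maximal matching. *)
Definition greedy_step M : {set T * U} :=
  if most_preferred prefA (free_candidates M) is Some x then
    if most_preferred prefB (free_neighbours M x) is Some y then (x, y) |: M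
    else M
  else M.

(* Every effective step matches a new element of [A], so #|A| steps reach the
   end of the loop; see [greedy_matching_maximal]. *)
Definition greedy_matching : {set T * U} := iter #|A| greedy_step set0.

Lemma most_preferred_ex (V : finType) (D E : {set V}) (r : rel V) :
  linear_preference D r -> E \subset D -> E != set0 ->
  exists2 x, most_preferred r E = Some x & x \in E.
Proof.
move=> [irr tr tot] sED /set0Pn[x0 x0E].
suff [x xE xP] : exists2 x, x \in E & [forall y in E, (y == x) || r x y].
  rewrite /most_preferred; case: pickP => [z /andP[zE _]|/(_ x)].
    by exists z.
  by rewrite xE xP.
pose dom x := #|[set y in E | r x y]|.
case: (arg_maxnP dom x0E) => x xE' xmax; have xE : x \in E := xE'; exists x => //.
apply/forallP => y; apply/implyP => yE; apply/orP.
have [->|nyx] := eqVneq y x; [by left | right].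
have xD := subsetP sED _ xE; have yD := subsetP sED _ yE.
case/orP: (tot y x yD xD nyx) => // ryx.
have /negP[] : ~~ (dom y <= dom x)%N; last exact: xmax.
rewrite -ltnNge; apply: proper_card; apply/properP; split.
  apply/subsetP => z; rewrite !inE => /andP[zE rxz]; rewrite zE /=.
  exact: (tr x y z xD yD (subsetP sED _ zE) ryx rxz).
have xEr u : (x \in [set z in E | r u z]) = r u x by rewrite in_set xE.
by exists x; rewrite xEr // irr.
Qed.

Lemma greedy_matching_maximal :
  linear_preference A prefA -> linear_preference B prefB ->
  maxset is_matching greedy_matching.
Proof.
move=> linA linB.
have stepP n : let M := iter n greedy_step set0 in
    is_matching M /\ (free_candidates M = set0 \/ #|matched_left M| = n).
  elim: n => [|n]; first (split; last by right; rewrite /matched_left imset0 cards0).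
    by apply/andP; split; apply/forallP => e; rewrite inE.
  rewrite /=; set M := iter n greedy_step set0 => -[mM dM].
  have [c0|cN] := eqVneq (free_candidates M) set0.
    rewrite /greedy_step.
    have -> : most_preferred prefA (free_candidates M) = None.
      rewrite c0 /most_preferred; case: pickP => // z; by rewrite inE.
    by split=> //; left.
  case: dM => [c0|cM]; first by rewrite c0 eqxx in cN.
  have sA : free_candidates M \subset A.
    by apply/subsetP => z; rewrite inE => /andP[].
  have [x ex xC] := most_preferred_ex linA sA cN.
  have /[!inE]/and3P[xA xM xN] := xC.
  have sB : free_neighbours M x \subset B.
    by apply/subsetP => z; rewrite inE => /andP[].
  have [y ey yC] := most_preferred_ex linB sB xN.
  have /[!inE]/and3P[yB yM xy] := yC.
  rewrite /greedy_step ex ey; split; last first.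
    by right; rewrite /matched_left imsetU1 cardsU1 [x \notin _]xM -/(matched_left M) cM.
  have neq e : e \in M -> (e.1 == x) = false /\ (e.2 == y) = false.
    move=> eM; split; apply/negbTE.
      by apply: contraNneq xM => <-; apply: imset_f.
    by apply: contraNneq yM => <-; apply: imset_f.
  case/andP: mM => /forall_inP m1 /forall_inP m2.
  apply/andP; split; apply/forall_inP => e /setU1P[->|eM] /=.
  - by rewrite xA yB xy.
  - exact: m1.
  - apply/forall_inP => f /setU1P[->|fM] /=; first by rewrite !eqxx.
    by have [n1 n2] := neq f fM; rewrite eq_sym n1 eq_sym n2.
  - apply/forall_inP => f /setU1P[->|fM] /=.
      by have [n1 n2] := neq e eM; rewrite n1 n2.
    by move/forall_inP: (m2 e eM); apply.
have [] := stepP #|A|; rewrite /= -/greedy_matching => mM cM.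
have c0 : free_candidates greedy_matching = set0.
  case: cM => // cA; apply/eqP; rewrite -subset0; apply/subsetP => x.
  have : matched_left greedy_matching == A.
    rewrite eqEcard cA leqnn andbT; apply/subsetP => z /imsetP[e eM ->].
    by case/andP: mM => /forall_inP /(_ e eM)/and3P[].
  by move=> /eqP eA; rewrite !inE eA andbA andbN.
apply/maxsetP; split=> // N mN sMN; apply/eqP; rewrite eqEsubset sMN andbT.
apply/subsetP => -[x y] xyN; apply: contraTT isT => xyM.
case/andP: mN => /forall_inP n1 /forall_inP n2.
have /= /and3P[xA yB xy] := n1 _ xyN.
have free e : e \in greedy_matching -> (x == e.1) || (y == e.2) -> False.
  move=> eM eq; have /forall_inP /(_ e (subsetP sMN _ eM)) := n2 _ xyN.
  by rewrite /= eq /= => /eqP eE; rewrite eE eM in xyM.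
suff : x \in free_candidates greedy_matching by rewrite c0 inE.
rewrite !inE xA /=; apply/andP; split.
  by apply/imsetP => -[e eM ex]; apply: (free e eM); rewrite ex eqxx.
apply/set0Pn; exists y; rewrite !inE yB xy andbT /=.
by apply/imsetP => -[e eM ey]; apply: (free e eM); rewrite ey eqxx orbT.
Qed.

End Greedy.

Definition consistent (X : finType) (c : {ffun X -> bool})
    (S : {set X * bool}) : bool :=
  [forall e in S, c e.1 == e.2].

Definition realizable_samples (X : finType) (C : {set {ffun X -> bool}}) :
    {set {set X * bool}} :=
  [set S | [exists c in C, consistent c S]].

Definition C_all (X : finType) : {set {ffun X -> bool}} := [set: {ffun X -> bool}].

(* The 0 branch is taken only when nothing is matched, which cannot happen for
   a nonempty class since the empty sample is consistent with every concept. *)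
Definition greedy_cost (X : finType) (C : {set {ffun X -> bool}})
    (prefC : rel {ffun X -> bool}) (prefS : rel {set X * bool}) : nat :=
  let M := greedy_matching C (realizable_samples C) (@consistent X) prefC prefS in
  if least_preferred prefS (matched_right M) is Some Sk then #|Sk| else 0.

Definition extends_cardinality (X : finType) (F : {set {set X * bool}})
    (prefS : rel {set X * bool}) : Prop :=
  {in F &, forall S S' : {set X * bool}, #|S| < #|S'| -> prefS S S'}.

Definition log2 (R : realType) (x : R) : R := (ln x / ln 2)%R.

(* Main.v *)
(** The matching saturates every concept, because the full sample of a concept
    is consistent with no other concept.  Hence the [2 ^ n] concepts (with
    [n = #|X|]) inject into the subsets of [X * bool] of size at most the cost
    [k].  Weighting a subset [S] by [3 ^ (2 * n - #|S|)] bounds the number of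
    those subsets by [3 ^ k * (4 / 3) ^ (2 * n)], so [(9 / 8) ^ n <= 3 ^ k];
    since [3 < (9 / 8) ^ 10], this forces [n <= 10 * k]. *)
Require Import Defs.
From mathcomp Require Import all_boot all_order all_algebra.
From mathcomp Require Import reals exp.

Set Implicit Arguments.
Unset Strict Implicit.
Unset Printing Implicit Defensive.

Import Order.TTheory GRing.Theory Num.Theory.

(** Since [least_preferred] is [most_preferred] for the reversed relation, this transfers
    [most_preferred_ex] to it. *)
Lemma linear_preference_rev (T : finType) (A : {set T}) (r : rel T) :
  linear_preference A r -> linear_preference A (fun x y => r y x).
Proof.
move=> [irr tr tot]; split=> //.
- by move=> y x z yA xA zA ryx rzy; apply: (tr y z x).
- by move=> x y xA yA; rewrite eq_sym => /(tot _ _ yA xA).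
Qed.

(** Expand the product of [1 + a] over [T]: [S] collects the factors that contribute [1], the others
    contribute [a]. *)
Lemma sum_expn_cardsC (T : finType) (a : nat) :
  \sum_(S : {set T}) a ^ #|~: S| = a.+1 ^ #|T|.
Proof.
rewrite -add1n -prod_nat_const bigA_distr; apply: eq_bigr => S _.
rewrite [RHS](bigID (mem S)) /= big1 ?mul1n => [|i ->//].
under [RHS]eq_bigr => i iS do rewrite (negbTE iS).
by rewrite -prod_nat_const; apply: eq_bigl => i; rewrite inE.
Qed.

Lemma card_small_sets_le (T : finType) (a k : nat) : 0 < a ->
  #|[set S : {set T} | #|S| <= k]| * a ^ #|T| <= a ^ k * a.+1 ^ #|T|.
Proof.
move=> a_gt0; rewrite -sum_expn_cardsC big_distrr -sum_nat_const /=.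
(* Only the small sets are kept from the sum; each satisfies [a ^ #|T| <= a ^ k * a ^ #|~: S|]. *)
rewrite [leqRHS](bigID (mem [set S : {set T} | #|S| <= k])) /=.
apply: leq_trans (leq_addr _ _); apply: leq_sum => S; rewrite inE => Sk.
by rewrite -expnD leq_pexp2l // -(cardsC S) leq_add2r.
Qed.

(* The hypothesis on squares gives [3 * b ^ 10 <= a ^ 10], as
   [3 <= (5 / 4) ^ 5]. *)
Lemma expn_gap_le (a b k n : nat) : b < a -> 5 * b ^ 2 <= 4 * a ^ 2 ->
  a ^ n <= 3 ^ k * b ^ n -> n <= 10 * k.
Proof.
move=> ltba gap count.
have pow10 : 3 * b ^ 10 <= a ^ 10.
  rewrite (expnM b 2 5) (expnM a 2 5) -(leq_pmul2l (isT : 0 < 4 ^ 5)) mulnA.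
  (* Numerically, [4 ^ 5 * 3 = 3072 <= 3125 = 5 ^ 5]. *)
  apply: (@leq_trans (5 ^ 5 * (b ^ 2) ^ 5)); first by rewrite leq_mul2r orbT.
  by rewrite -!expnMn leq_exp2r.
(* Otherwise [n = 10 * k + r] with [r > 0], and the strict inequality [b ^ r < a ^ r] contradicts
   [count]. *)
have [//|ltkn] := leqP n (10 * k); move: count.
rewrite leqNgt => /negP[]; rewrite -(subnKC (ltnW ltkn)).
have : 0 < n - 10 * k by rewrite subn_gt0.
move: (n - 10 * k) => r r_gt0.
rewrite !(expnD _ (10 * k)) mulnA !(expnM _ 10 k) -expnMn.
apply: (@leq_ltn_trans ((a ^ 10) ^ k * b ^ r)).
  rewrite leq_mul2r; case: (k) => [|j]; first by rewrite orbT.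
  by rewrite leq_exp2r // pow10 orbT.
by rewrite ltn_pmul2l ?ltn_exp2r // !expn_gt0 (leq_trans _ ltba).
Qed.

Section GreedyCost.

Variables (X : finType) (prefC : rel {ffun X -> bool}).
Variable prefS : rel {set X * bool}.

Let C := C_all X.
Let F := realizable_samples C.
Let M := greedy_matching C F (@consistent X) prefC prefS.

(** The graph of [c], a vertex of the consistency graph whose only neighbour is [c]. *)
Definition full_sample (c : {ffun X -> bool}) : {set X * bool} :=
  [set e | c e.1 == e.2].

Lemma consistent_full_sample (c d : {ffun X -> bool}) :
  consistent d (full_sample c) = (d == c).
Proof.
apply/forall_inP/eqP => [cons|-> e]; last by rewrite inE.
by apply/ffunP => x; apply/eqP/(cons (x, c x)); rewrite inE.
Qed.

Lemma full_sample_realizable (c : {ffun X -> bool}) : full_sample c \in F.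
Proof.
by rewrite inE; apply/exists_inP; exists c; rewrite ?inE ?consistent_full_sample.
Qed.

Hypotheses (linC : linear_preference C prefC) (linS : linear_preference F prefS).

Let M_max : maxset (is_matching C F (@consistent X)) M.
Proof. exact: greedy_matching_maximal. Qed.

Let M_edge (e : {ffun X -> bool} * {set X * bool}) :
  e \in M -> e.2 \in F /\ consistent e.1 e.2.
Proof.
move=> eM; have /maxsetp/andP[/forall_inP/(_ e eM)/and3P[_ eF ce] _] := M_max.
by split.
Qed.

Let M_inj (e f : {ffun X -> bool} * {set X * bool}) :
  e \in M -> f \in M -> (e.1 == f.1) || (e.2 == f.2) -> e = f.
Proof.
move=> eM fM ef; have /maxsetp/andP[_ /forall_inP/(_ e eM)] := M_max.
by move=> /forall_inP/(_ f fM)/implyP/(_ ef)/eqP.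
Qed.

(** If [c] were unmatched, so would be its full sample, which only [c] can match; adding this pair
    would contradict maximality. *)
Lemma greedy_matching_saturates : matched_left M = C.
Proof.
apply/setP => c; rewrite [RHS]inE; apply/negPn/negP => cM.
have nF e : e \in M -> (c == e.1) || (full_sample c == e.2) = false.
  move=> eM; have ce : e.1 != c.
    by apply: contraNneq cM => <-; apply: imset_f.
  rewrite eq_sym (negbTE ce) /=; apply/eqP => eF.
  by have [_] := M_edge eM; rewrite -eF consistent_full_sample (negbTE ce).
case/maxsetP: (M_max) => /andP[/forall_inP m1 /forall_inP m2].
move/(_ ((c, full_sample c) |: M)) => Mmax.
have MU : (c, full_sample c) |: M = M.
  apply: Mmax; last exact: subsetUr.
  apply/andP; split; apply/forall_inP => e /setU1P[->|eM] /=.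
  - by rewrite inE full_sample_realizable consistent_full_sample eqxx.
  - exact: m1.
  - by apply/forall_inP => f /setU1P[->|fM] /=; rewrite ?eqxx // nF.
  - apply/forall_inP => f /setU1P[->|fM] /=.
      by rewrite [e.1 == _]eq_sym [e.2 == _]eq_sym nF.
    by move/forall_inP: (m2 e eM); apply.
by case/negP: cM; apply/imsetP; exists (c, full_sample c); rewrite // -MU setU11.
Qed.

(** Both projections are injective on a matching, so there are as many matched samples as matched
    concepts. *)
Lemma card_matched_right : #|matched_right M| = 2 ^ #|X|.
Proof.
rewrite card_in_imset => [|e f eM fM ef].
  rewrite -card_bool -card_ffun -cardsT -/(C_all X) -/C.
  rewrite -greedy_matching_saturates card_in_imset // => e f eM fM ef.
  by apply: M_inj => //; rewrite ef eqxx.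
by apply: M_inj => //; rewrite ef eqxx orbT.
Qed.

Lemma matched_right_realizable : matched_right M \subset F.
Proof. by apply/subsetP => S /imsetP[e /M_edge[eF _] ->]. Qed.

Lemma card_matched_le_greedy_cost (S : {set X * bool}) :
  extends_cardinality F prefS ->
  S \in matched_right M -> #|S| <= greedy_cost C prefC prefS.
Proof.
move=> extS SM; have sF := subsetP matched_right_realizable.
rewrite /greedy_cost -/F -/M /least_preferred.
(* As [S] is matched, the default cost 0 does not arise. *)
have NM : matched_right M != set0 by apply/set0Pn; exists S.
have [T eT _] := most_preferred_ex (linear_preference_rev linS)
  matched_right_realizable NM.
rewrite eT; move: eT; rewrite /most_preferred.
case: pickP => // _ /[swap] -[->] /andP[TM /forall_inP/(_ S SM) TS].
(* A larger [S] would be both preferred to the least preferred [T] and, by cardinality, less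
   preferred than it. *)
rewrite leqNgt; apply/negP => ltTS; case/orP: TS => [/eqP eST|rST].
  by rewrite eST ltnn in ltTS.
have [SF TF] := (sF _ SM, sF _ TM).
have rTS := extS _ _ TF SF ltTS; case: linS => irr tr _.
by have := tr _ _ _ TF SF SF rST rTS; rewrite irr.
Qed.

Lemma greedy_cost_ge :
  extends_cardinality F prefS -> #|X| <= 10 * greedy_cost C prefC prefS.
Proof.
move=> extS; set k := greedy_cost C prefC prefS; set n := #|X|.
(* The weight 3 is the least natural [a] with [a.+1 ^ 2 < 2 * a ^ 2]; the squares arise from
   [#|X * bool| = 2 * n]. *)
have count : 2 ^ n * 9 ^ n <= 3 ^ k * 16 ^ n.
  have := @card_small_sets_le (X * bool)%type 3 k isT.
  rewrite card_prod card_bool -/n mulnC [n * 2]mulnC !expnM mulnC.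
  apply: leq_trans; rewrite leq_mul2r -card_matched_right subset_leq_card ?orbT //.
  by apply/subsetP => S SM; rewrite inE; apply: card_matched_le_greedy_cost.
(* Here [18 = 2 * 9], and [5 * 16 ^ 2 = 1280 <= 1296 = 4 * 18 ^ 2]. *)
by apply: (expn_gap_le (isT : 16 < 18)) => //; rewrite (expnMn 2 9).
Qed.

End GreedyCost.

Local Open Scope ring_scope.

Lemma log2_card_C_all (R : realType) (X : finType) :
  log2 (#|C_all X|%:R : R) = #|X|%:R.
Proof.
rewrite /log2 cardsT card_ffun card_bool natrX lnXn // -[ln _ *+ _]mulr_natl mulfK //.
by rewrite gt_eqF // ln_gt0 // ltr1n.
Qed.

Theorem theorem4 (R : realType) :
  exists gamma0 : R, 0 < gamma0 /\
    forall (X : finType)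
           (prefC : rel {ffun X -> bool}) (prefS : rel {set X * bool}),
      linear_preference (C_all X) prefC ->
      linear_preference (realizable_samples (C_all X)) prefS ->
      extends_cardinality (realizable_samples (C_all X)) prefS ->
      gamma0 * log2 (#|C_all X|%:R : R) <= (greedy_cost (C_all X) prefC prefS)%:R
      /\ gamma0 * log2 (#|C_all X|%:R : R) = gamma0 * #|X|%:R.
Proof.
exists 10%:R^-1; split=> [|X prefC prefS linC linS extS].
  by rewrite invr_gt0 ltr0n.
rewrite log2_card_C_all; split=> //.
by rewrite ler_pdivrMl ?ltr0n // -natrM ler_nat greedy_cost_ge.
Qed.
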